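(* Let $\Sigma=(A_t,B_t,C_t,D_t)$ be an $(m,n)$-multirate system with state space $X$, input space $U$ and output space $Y$, and let $q\in\mathbb Z^+$ with $m/q,n/q\in\mathbb Z$. Put $T:=m\overline n$, $T':=T/q$, $\epsilon:=e^{2\pi j/T}$, and let $\widehat A_k,\widehat B_k,\widehat C_k$ ($k\in\mathbb Z$, indices mod $T$) be the period-$T$ Fourier coefficients of $A,B,C$. Define $T'$-periodic sequences $\widetilde A_t:X^q\to X^q$, $\widetilde B_t:U\to X^q$, $\widetilde C_t:X^q\to Y$, $\widetilde D_t:U\to Y$ by $\widetilde A_t=\sum_{r=0}^{T'-1}\widehat{\widetilde A}_re^{2\pi jtr/T'}$ (and similarly for $\widetilde B,\widetilde C$), where for $0\le r<T'$ \[ \widehat{\widetilde A}_r=\big(\widehat A_{rq+i-k}\,\epsilon^{-k}\big)_{i,k=0}^{q-1},\qquad \widehat{\widetilde B}_r=\mathrm{col}\big(\widehat B_{rq+i}\big)_{i=0}^{q-1},\qquad \widehat{\widetilde C}_r=\mathrm{row}\big(\widehat C_{rq-k}\,\epsilon^{-k}\big)_{k=0}^{q-1}, \] and $\widetilde D_t:=\frac1q\sum_{k=0}^{q-1}D_{t+kT'}$ for $0\le t<T'$. Then the $(m/q,n/q)$-multirate system $\widetilde\Sigma=(\widetilde A_t,\widetilde B_t,\widetilde C_t,\widetilde D_t)$ with state space $X^q$ (input space $U$, output space $Y$) is a $|\cdot|$-optimal $(m/q,n/q)$-multirate approximation of $\Sigma$. The statement remains true if $\widetilde A,\widetilde B,\widetilde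 C$ are instead defined through \[ \widehat{\widetilde A}_r=\big(\epsilon^{-i}\,\widehat A_{rq+i-k}\big)_{i,k=0}^{q-1},\qquad \widehat{\widetilde B}_r=\mathrm{col}\big(\epsilon^{-i}\,\widehat B_{rq+i}\big)_{i=0}^{q-1},\qquad \widehat{\widetilde C}_r=\mathrm{row}\big(\widehat C_{rq-k}\big)_{k=0}^{q-1}. \]
   Context: $j$ is the imaginary unit; $U,X,Y$ are separable complex Hilbert spaces. Upsampler $(\uparrow_q v)_t=v_{t/q}$ if $q\mid t$, else $0$; downsampler $(\downarrow_q v)_t=v_{qt}$. For $m,n\in\mathbb Z^+$, $c=\gcd(m,n)$, $\overline m=m/c$, $\overline n=n/c$ (note $(m/q,n/q)$ has the same $\overline m,\overline n$). An $(m,n)$-multirate system consists of $m\overline n$-periodic bounded operator sequences $A_t:X\to X$, $B_t:U\to X$, $C_t:X\to Y$, $D_t:U\to Y$ with $x_{t+1}=A_tx_t+B_tu^\circ_t$, $y^\circ_t=C_tx_t+D_tu^\circ_t$, $u^\circ=\uparrow_{\overline m}u$, $y=\downarrow_{\overline n}y^\circ$; it is also $(km,kn)$-multirate for all $k\in\mathbb Z^+$. Fourier coefficients of a $T$-periodic sequence: $\widehat A_k=\frac1T\sum_{t=0}^{T-1}A_te^{-2\pi jtk/T}$. In the claim, $(\cdot)_{i,k=0}^{q-1}$ denotes the $q\times q$ block operator matrix on $X^q$ with the given $(i,k)$ entry, col a column and row a row of operators. Harmonic transfer function: with $\mathcal T_T(A)$ the $T\times T$ block matrix with entry $\widehat A_{(r-\ell)\bmod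 T}$ at $(r,\ell)$, $\mathcal N_T:=\mathrm{diag}(e^{2\pi jk/T}I)_{k=0}^{T-1}$, $\Pi_{T,1,q}:V^T\to V^{qT}$ stacking $q$ copies and $\Pi^*_{T,1,q}$ summing the $q$ blocks, an $(M,N)$-multirate system has harmonic transfer function $\mathcal H(z)=\Pi_{M,1,\overline n}^*\big(z\mathcal C(\mathcal N_{M\overline n}-z\mathcal A)^{-1}\mathcal B+\mathcal D\big)\Pi_{N,1,\overline m}/\overline m:U^N\to Y^M$ (defined for $z$ near $0$), with $\mathcal A,\dots,\mathcal D$ the period-$M\overline n$ Toeplitz transforms. Norm: with $H_i(z)=\sum_kz^kh_{i,k}$ the entry in row $i$, column $0$ of $\mathcal H(z)$, $|\mathcal H|^2:=\sum_{i=0}^{M-1}\sum_\ell\sum_{k\ge0}\|h_{i,k}e_\ell\|^2\in[0,\infty]$, $(e_\ell)$ an orthonormal basis of $U$. Error system: for $\Sigma$ $(c\overline m,c\overline n)$-multirate and $\widehat\Sigma$ $(\widehat c\,\overline m,\widehat c\,\overline n)$-multirate, $\Sigma-\widehat\Sigma$ is the $(C\overline m,C\overline n)$-multirate system, $C=\mathrm{lcm}(c,\widehat c)$, with state space $X\oplus\widehat X$ and operators $\mathrm{diag}(A_t,\widehat A_t)$, $\mathrm{col}(B_t,\widehat B_t)$, $\mathrm{row}(C_t,-\widehat C_t)$, $D_t-\widehat D_t$. An $(m',n')$-multirate system $\widetilde\Sigma$ (input $U$, output $Y$) is a $|\cdot|$-optimal $(m',n')$-multirate approximation of $\Sigma$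 if $|\mathcal G_{\Sigma-\widetilde\Sigma}|\le|\mathcal G_{\Sigma-\widehat\Sigma}|$ for all $(m',n')$-multirate $\widehat\Sigma$ with input $U$ and output $Y$, where $\mathcal G_{\Sigma-\widehat\Sigma}$ is the harmonic transfer function of the error system. *)

(* Defs.v *)
From HB Require Import structures.
From mathcomp Require Import all_boot all_order all_algebra.
From mathcomp Require Import all_classical all_reals all_analysis.
From mathcomp Require Import complex.
Set Implicit Arguments. Unset Strict Implicit. Unset Printing Implicit Defensive.
Import Order.TTheory GRing.Theory Num.Theory.
Local Open Scope ring_scope.

Definition cexp (R : realType) (x : R) : R[i] := (cos x +i* sin x)%C.

Definition hnorm (R : realType) (V : lmodType R[i]) (ip : V -> V -> R[i]) (x : V) : R :=
  Num.sqrt (complex.Re (ip x x)).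

Definition is_hilbert (R : realType) (V : lmodType R[i]) (ip : V -> V -> R[i]) : Prop :=
  [/\ (forall x y, ip y x = conjc (ip x y)),
      (forall (a : R[i]) x y z, ip (a *: x + y) z = a * ip x z + ip y z),
      (forall x, 0 <= ip x x),
      (forall x, ip x x = 0 -> x = 0) &
      ((forall u : nat -> V,
          (forall eps : R, 0 < eps -> exists N, forall k l, (N <= k)%N -> (N <= l)%N ->
               hnorm ip (u k - u l) < eps) ->
          exists x, forall eps : R, 0 < eps -> exists N, forall k, (N <= k)%N ->
               hnorm ip (u k - x) < eps) /\
      (exists d : nat -> V, forall x (eps : R), 0 < eps -> exists k, hnorm ip (x - d k) < eps))].

Definition bounded_op (R : realType) (V W : lmodType R[i])
  (ipV : V -> V -> R[i]) (ipW : W -> W -> R[i]) (f : V -> W) : Prop :=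
  (forall (a : R[i]) x y, f (a *: x + y) = a *: f x + f y) /\
  exists M : R, forall x, hnorm ipW (f x) <= M * hnorm ipV x.

Definition is_onb (R : realType) (V : lmodType R[i]) (ip : V -> V -> R[i])
  (L : set nat) (e : nat -> V) : Prop :=
  (forall l l', L l -> L l' -> ip (e l) (e l') = (l == l')%:R) /\
  (forall x, (forall l, L l -> ip x (e l) = 0) -> x = 0).

Record msys (R : realType) (U X Y : lmodType R[i]) := MSys {
  sA : nat -> X -> X;
  sB : nat -> U -> X;
  sC : nat -> X -> Y;
  sD : nat -> U -> Y }.

Definition mperiod (m n : nat) : nat := (m * (n %/ gcdn m n))%N.

Definition is_multirate (R : realType) (U X Y : lmodType R[i])
  (ipU : U -> U -> R[i]) (ipX : X -> X -> R[i]) (ipY : Y -> Y -> R[i])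
  (m n : nat) (S : msys U X Y) : Prop :=
  [/\ (0 < m)%N, (0 < n)%N,
      (forall t, [/\ sA S (t + mperiod m n) = sA S t, sB S (t + mperiod m n) = sB S t,
                     sC S (t + mperiod m n) = sC S t & sD S (t + mperiod m n) = sD S t]) &
      (forall t, [/\ bounded_op ipX ipX (sA S t), bounded_op ipU ipX (sB S t),
                     bounded_op ipX ipY (sC S t) & bounded_op ipU ipY (sD S t)])].

Definition fcoef (R : realType) (V W : lmodType R[i]) (T : nat) (F : nat -> V -> W)
  (k : int) : V -> W :=
  fun v => (T%:R)^-1 *: \sum_(t < T) cexp (- (2 * pi * (t%:R * k%:~R)) / T%:R) *: F t v.

(* Toeplitz transform T_P(F) acting on vectors in V^P (represented as nat -> V) *)
Definition toep (R : realType) (V W : lmodType R[i]) (P : nat) (F : nat -> V -> W)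
  (v : nat -> V) : nat -> W :=
  fun r => \sum_(l < P) fcoef P F ((r%:Z - l%:Z) %% P%:Z)%Z (v l).

Definition ninv (R : realType) (V : lmodType R[i]) (P : nat) (v : nat -> V) : nat -> V :=
  fun r => cexp (- (2 * pi * r%:R) / P%:R) *: v r.

(* h_{i,k} u : coefficient of z^k of the entry (i,0) of the harmonic transfer
   function of S regarded as an (M,N)-multirate system, applied to u.
   Here (N_P - z A)^{-1} = sum_k z^k (N_P^{-1} A)^k N_P^{-1} (formal power series
   inverse / Neumann series near z = 0), so the coefficient of z^0 of
   z C (N - zA)^{-1} B + D is D and that of z^{k+1} is C (N^{-1} A)^k N^{-1} B.
   The input vector Pi_{N,1,mbar} (u,0,...,0) has u at the positions p < P with N | p. *)
Definition htf_coef (R : realType) (U X Y : lmodType R[i]) (M N : nat)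
  (S : msys U X Y) (i k : nat) (u : U) : Y :=
  let c := gcdn M N in
  let mb := (M %/ c)%N in
  let nb := (N %/ c)%N in
  let P := (M * nb)%N in
  let v : nat -> U := fun p => if (N %| p)%N then u else 0 in
  let g : nat -> Y :=
    match k with
    | 0%N => toep P (sD S) v
    | k'.+1 => toep P (sC S)
                 (iter k' (fun w => ninv P (toep P (sA S) w)) (ninv P (toep P (sB S) v)))
    end in
  (mb%:R)^-1 *: \sum_(b < nb) g (b * M + i)%N.

Definition htf_norm2 (R : realType) (U X Y : lmodType R[i])
  (ipY : Y -> Y -> R[i]) (L : set nat) (e : nat -> U) (M N : nat) (S : msys U X Y)
  : \bar R :=
  (\sum_(i < M) \esum_(l in L) \esum_(k in [set: nat])
      ((hnorm ipY (htf_coef M N S i k (e l))) ^+ 2)%:E)%E.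

Definition err_sys (R : realType) (U X Xh Y : lmodType R[i])
  (S : msys U X Y) (Sh : msys U Xh Y) : msys U (X * Xh)%type Y :=
  MSys (fun t (x : X * Xh) => (sA S t x.1, sA Sh t x.2))
       (fun t u => (sB S t u, sB Sh t u))
       (fun t (x : X * Xh) => sC S t x.1 - sC Sh t x.2)
       (fun t u => sD S t u - sD Sh t u).

(* |G_{S - Sh}|^2, with S (c mbar, c nbar)-multirate and Sh (ch mbar, ch nbar)-multirate:
   the error system is (C mbar, C nbar)-multirate, C = lcm(c, ch). *)
Definition err_norm2 (R : realType) (U X Xh Y : lmodType R[i])
  (ipY : Y -> Y -> R[i]) (L : set nat) (e : nat -> U)
  (m n : nat) (S : msys U X Y) (m' n' : nat) (Sh : msys U Xh Y) : \bar R :=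
  let c := gcdn m n in
  let C := lcmn c (gcdn m' n') in
  htf_norm2 ipY L e (C * (m %/ c))%N (C * (n %/ c))%N (err_sys S Sh).

Definition optimal_approx (R : realType) (U X Xt Y : lmodType R[i])
  (ipU : U -> U -> R[i]) (ipY : Y -> Y -> R[i]) (L : set nat) (e : nat -> U)
  (m n : nat) (S : msys U X Y) (m' n' : nat) (St : msys U Xt Y) : Prop :=
  forall (Xh : lmodType R[i]) (ipXh : Xh -> Xh -> R[i]), is_hilbert ipXh ->
  forall Sh : msys U Xh Y, is_multirate ipU ipXh ipY m' n' Sh ->
    (err_norm2 ipY L e m n S m' n' St <= err_norm2 ipY L e m n S m' n' Sh)%E.

Definition ip_pow (R : realType) (X : lmodType R[i]) (q : nat) (ipX : X -> X -> R[i])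
  (x y : {ffun 'I_q -> X}) : R[i] := \sum_(i < q) ipX (x i) (y i).

Definition tilde_sys1 (R : realType) (U X Y : lmodType R[i]) (m n q : nat)
  (S : msys U X Y) : msys U {ffun 'I_q -> X} Y :=
  let T := mperiod m n in
  let Tp := (T %/ q)%N in
  let epsinv (k : nat) : R[i] := cexp (- (2 * pi * k%:R) / T%:R) in
  let w (t r : nat) : R[i] := cexp (2 * pi * (t%:R * r%:R) / Tp%:R) in
  MSys
    (fun t (x : {ffun 'I_q -> X}) => [ffun i : 'I_q =>
       \sum_(r < Tp) w t r *: \sum_(k < q)
          epsinv k *: fcoef T (sA S) ((r * q + i)%:Z - k%:Z)%R (x k)])
    (fun t u => [ffun i : 'I_q =>
       \sum_(r < Tp) w t r *: fcoef T (sB S) (r * q + i)%N%:Z u])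
    (fun t (x : {ffun 'I_q -> X}) =>
       \sum_(r < Tp) w t r *: \sum_(k < q)
          epsinv k *: fcoef T (sC S) ((r * q)%:Z - k%:Z)%R (x k))
    (fun t u => (q%:R)^-1 *: \sum_(k < q) sD S (t %% Tp + k * Tp)%N u).

Definition tilde_sys2 (R : realType) (U X Y : lmodType R[i]) (m n q : nat)
  (S : msys U X Y) : msys U {ffun 'I_q -> X} Y :=
  let T := mperiod m n in
  let Tp := (T %/ q)%N in
  let epsinv (k : nat) : R[i] := cexp (- (2 * pi * k%:R) / T%:R) in
  let w (t r : nat) : R[i] := cexp (2 * pi * (t%:R * r%:R) / Tp%:R) in
  MSys
    (fun t (x : {ffun 'I_q -> X}) => [ffun i : 'I_q =>
       \sum_(r < Tp) w t r *: (epsinv i *: \sum_(k < q)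
          fcoef T (sA S) ((r * q + i)%:Z - k%:Z)%R (x k))])
    (fun t u => [ffun i : 'I_q =>
       \sum_(r < Tp) w t r *: (epsinv i *: fcoef T (sB S) (r * q + i)%N%:Z u)])
    (fun t (x : {ffun 'I_q -> X}) =>
       \sum_(r < Tp) w t r *: \sum_(k < q)
          fcoef T (sC S) ((r * q)%:Z - k%:Z)%R (x k))
    (fun t u => (q%:R)^-1 *: \sum_(k < q) sD S (t %% Tp + k * Tp)%N u).

(* Main.v *)
Require Import Defs.
From HB Require Import structures.
From mathcomp Require Import all_boot all_order all_algebra.
From mathcomp Require Import all_classical all_reals all_analysis.
From mathcomp Require Import complex.
From mathcomp Require Import zify ring lra.
Import Order.TTheory GRing.Theory Num.Theory.
Local Open Scope ring_scope.
Set Implicit Arguments.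
Unset Strict Implicit.
Unset Printing Implicit Defensive.

(** The argument is a least-squares one in the time domain. The coefficient
h_{i,k} of the harmonic transfer function is the i-th discrete Fourier
coefficient, in the output time s < M, of the impulse response with delay k
along the times compatible with the two samplers; hence by Parseval the squared
norm is, up to the factor 1/M, the sum of the squared norms of the impulse
response over output times, delays and basis vectors. An approximation of
period T' = T/q has an impulse response that is T'-periodic in time, so for
every delay the best one can do is the mean of the impulse response of the
system over the q shifts by T'. The compressed systems realise exactly this
mean: run the q time-shifted copies of the system in parallel; the i-th block of
the state is the i-th discrete Fourier coefficient, across the copies, of their
states, demodulated by epsilon^(-i t), up to the normalisation of t that
distinguishes the two realisations. *)

(** * Roots of unity *)

Section RootsOfUnity.
Variable R : realType.
Implicit Types (P : nat) (z : int).

Lemma cexp0 : cexp (0 : R) = 1.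
Proof. by rewrite /cexp cos0 sin0. Qed.

Lemma cexpD (x y : R) : cexp (x + y) = cexp x * cexp y.
Proof.
rewrite /cexp cosD sinD; apply/eqP; rewrite eq_complex /= eqxx /=.
by apply/eqP; rewrite addrC.
Qed.

Definition uroot P z : R[i] := cexp (2 * pi * z%:~R / P%:R).

Lemma uroot0 P : uroot P 0 = 1.
Proof. by rewrite /uroot mulr0 mul0r cexp0. Qed.

Lemma urootD P z1 z2 : uroot P (z1 + z2) = uroot P z1 * uroot P z2.
Proof. by rewrite /uroot intrD mulrDr mulrDl cexpD. Qed.

Lemma conj_uroot P z : conjc (uroot P z) = uroot P (- z).
Proof. by rewrite /uroot /cexp /= mulrNz mulrN mulNr cosN sinN. Qed.

Lemma uroot_exp P z (k : nat) : uroot P (z * k%:Z) = uroot P z ^+ k.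
Proof.
elim: k => [|k IH]; first by rewrite mulr0 uroot0.
by rewrite -addn1 PoszD mulrDr mulr1 urootD IH exprD.
Qed.

Lemma uroot_scale P z (a : nat) : (0 < a)%N -> uroot (P * a) (z * a%:Z) = uroot P z.
Proof.
move=> a0; rewrite /uroot intrM natrM invfM; congr cexp.
have a0' : (a%:R : R) != 0 by rewrite pnatr_eq0 -lt0n.
by rewrite -[(Posz a)%:~R]/(a%:R : R) !mulrA mulrAC mulfK.
Qed.

Lemma uroot_dvd P z : (P%:Z %| z)%Z -> uroot P z = 1.
Proof.
case: P => [|P] /dvdzP [k ->].
  by rewrite /uroot invr0 mulr0 cexp0.
have H j : uroot P.+1 (P.+1%:Z * j%:Z) = 1.
  rewrite uroot_exp /uroot -mulrA mulfV ?pnatr_eq0 // mulr1 /cexp.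
  by rewrite mulr_natl cos2pi sin2pi; apply: expr1n.
case: k => j; first by rewrite mulrC H.
rewrite NegzE mulNr mulrC.
have := urootD P.+1 (P.+1%:Z * j.+1%:Z) (- (P.+1%:Z * j.+1%:Z)).
by rewrite subrr uroot0 H mul1r => <-.
Qed.

Lemma uroot_mod P z1 z2 : (P%:Z %| z1 - z2)%Z -> uroot P z1 = uroot P z2.
Proof. by move=> h; rewrite -[z1](subrK z2) urootD uroot_dvd // mul1r. Qed.

(** After reducing [z] to a residue $0<r<P$, the half angle $y=\pi r/P$ lies in $(0,\pi)$, so $\sin
    y>0$ and $\cos 2y=1-2\sin^2y<1$. *)
Lemma uroot_neq1 P z : (0 < P)%N -> ~~ (P%:Z %| z)%Z -> uroot P z != 1.
Proof.
move=> P0 Pz; have P0' : P%:Z != 0 by lia.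
rewrite (@uroot_mod P z (z %% P%:Z)%Z); last first.
  by apply/dvdzP; exists (z %/ P%:Z)%Z; rewrite {1}(divz_eq z P%:Z) addrK.
have : (z %% P%:Z)%Z != 0 by apply: contra Pz => /eqP h; apply/dvdz_mod0P.
have := modz_ge0 z P0'; have := ltz_mod z P0'.
case: (z %% P%:Z)%Z => // r rP' _ r0; have rP : (r < P)%N by lia.
set y : R := pi * r%:R / P%:R.
have P0R : (0 < P%:R :> R) by rewrite ltr0n.
have sy : 0 < sin y.
  apply: sin_gt0_pi; apply/andP; split.
    by rewrite divr_gt0 // mulr_gt0 ?pi_gt0 // ltr0n; lia.
  by rewrite ltr_pdivrMr // ltr_pM2l ?pi_gt0 // ltr_nat.
apply/eqP => /(congr1 (@complex.Re R)) /=.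
have -> : 2 * pi * (Posz r)%:~R / P%:R = y + y :> R.
  by rewrite -[(Posz r)%:~R]/(r%:R : R) /y -!mulrA mulr_natl mulr2n.
rewrite cosD; have := cos2Dsin2 y; nra.
Qed.

Lemma sum_uroot P z : (0 < P)%N ->
  \sum_(k < P) uroot P (z * k%:Z) = if (P%:Z %| z)%Z then P%:R else 0.
Proof.
move=> P0; under eq_bigr do rewrite uroot_exp.
case: ifP => [/uroot_dvd ->|/negbT Pz].
  by under eq_bigr do rewrite expr1n; rewrite sumr_const card_ord.
have := subrX1 (uroot P z) P; rewrite -uroot_exp uroot_dvd ?dvdz_mull //.
rewrite subrr => /esym /eqP; rewrite mulf_eq0 subr_eq0.
by rewrite (negbTE (uroot_neq1 P0 Pz)) => /eqP.
Qed.

End RootsOfUnity.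

(** * Discrete Fourier transform *)

Section LinearMaps.
Variables (R : realType) (V W : lmodType R[i]).

Definition islin (f : V -> W) := forall (a : R[i]) x y, f (a *: x + y) = a *: f x + f y.

(** The operators of a system are bare functions; packing one as a linear map gives access to the
    library lemmas on scalars and finite sums. *)
Lemma islinP (f : V -> W) : islin f -> exists g : {linear V -> W}, f = g.
Proof.
move=> lf; pose h := GRing.isLinear.Build R[i] V W *:%R f lf.
by exists (HB.pack_for {linear V -> W} f h).
Qed.

Lemma lin0 f : islin f -> f 0 = 0.
Proof. by move=> /islinP[g ->]; rewrite linear0. Qed.

Lemma linZ f a x : islin f -> f (a *: x) = a *: f x.
Proof. by move=> /islinP[g ->]; rewrite linearZ. Qed.

Lemma lin_sum f I (r : seq I) (p : pred I) (F : I -> V) : islin f ->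
  f (\sum_(i <- r | p i) F i) = \sum_(i <- r | p i) f (F i).
Proof. by move=> /islinP[g ->]; rewrite linear_sum. Qed.

End LinearMaps.

Lemma sum_ord_mul (V : nmodType) (m n : nat) (F : nat -> V) :
  \sum_(t < m * n) F t = \sum_(s < m) \sum_(b < n) F (s * n + b)%N.
Proof.
elim: m => [|m IH]; first by rewrite mul0n !big_ord0.
by rewrite mulSnr big_split_ord /= IH big_ord_recr.
Qed.

Section FourierTransform.
Variables (R : realType) (V : lmodType R[i]).

Definition dft P (f : nat -> V) (k : int) : V :=
  (P%:R)^-1 *: \sum_(t < P) uroot R P (- (t%:Z * k)) *: f t.

Lemma eq_dft P f g k : (forall t, (t < P)%N -> f t = g t) -> dft P f k = dft P g k.
Proof. by move=> fg; congr (_ *: _); apply: eq_bigr => t _; rewrite fg. Qed.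

(** Orthogonality of characters: the sum over frequencies kills every time [s] other than [t], since
    $|t-s|<P$. *)
Lemma idft P f t : (t < P)%N ->
  \sum_(l < P) uroot R P (t%:Z * l%:Z) *: dft P f l%:Z = f t.
Proof.
move=> tP; have P0 : (0 < P)%N by lia.
transitivity (\sum_(s < P) ((P%:R)^-1 * \sum_(l < P) uroot R P ((t%:Z - s%:Z) * l%:Z)) *: f s).
  under eq_bigr do rewrite /dft !scaler_sumr.
  rewrite exchange_big; apply: eq_bigr => s _ /=.
  rewrite mulr_sumr scaler_suml; apply: eq_bigr => l _.
  by rewrite !scalerA mulrBl urootD mulrCA mulrA.
rewrite (bigD1 (Ordinal tP)) //= [X in _ + X]big1 ?addr0 => [|s st].
  by rewrite sum_uroot // subrr dvdz0 mulVf ?scale1r // pnatr_eq0; lia.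
rewrite sum_uroot // ifF ?mulr0 ?scale0r //; apply/negbTE/negP => /dvdzP[k hk].
have ts : s <> t :> nat by move=> h; case/eqP: st; apply: val_inj.
have := ltn_ord s; have [k0|[k0|k0]] : k <= -1 \/ k = 0 \/ 1 <= k by lia.
- nia.
- lia.
- nia.
Qed.

(** Multiplying coefficient [r] by $e^{-2\pi jr/P}$ is a delay by one step in time; [f' P = f' 0]
    makes the delay cyclic. *)
Lemma ninv_dft P f f' : (forall t, (t < P)%N -> f' t.+1 = f t) -> f' P = f' 0 ->
  ninv P (fun r => dft P f r%:Z) = (fun r => dft P f' r%:Z).
Proof.
move=> ff' f'P; apply/funext => r; rewrite /ninv /dft scalerA mulrC -scalerA scaler_sumr.
congr (_ *: _).
have -> : cexp (- (2 * pi * r%:R) / P%:R) = uroot R P (- r%:Z).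
  by rewrite /uroot mulrNz mulrN.
transitivity (\sum_(t < P) uroot R P (- (t.+1%:Z * r%:Z)) *: f' t.+1).
  apply: eq_bigr => t _; rewrite scalerA -urootD ff' //; congr (uroot _ _ _ *: _); lia.
case: P ff' f'P => [|P] ff' f'P; first by rewrite !big_ord0.
rewrite big_ord_recr [RHS]big_ord_recl /= f'P addrC; congr (_ *: _ + _).
by rewrite mul0r oppr0 uroot0 uroot_dvd // -mulrN dvdz_mulr.
Qed.

(** This is the output downsampler: summing over the frequencies congruent to [i] mod [M] keeps only
    the samples at multiples of [n]. *)
Lemma sum_dft_decimate (M n i : nat) f : (0 < M)%N -> (0 < n)%N ->
  \sum_(b < n) dft (M * n) f (b * M + i)%N%:Z =
  (M%:R)^-1 *: \sum_(s < M) uroot R M (- (s%:Z * i%:Z)) *: f (s * n)%N.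
Proof.
move=> M0 n0; rewrite -scaler_sumr natrM invfM -scalerA; congr (_ *: _).
rewrite exchange_big /=.
have H (t : nat) : \sum_(b < n) uroot R (M * n) (- (t%:Z * (b * M + i)%N%:Z)) *: f t =
    ((if (n%:Z %| t%:Z)%Z then n%:R else 0) * uroot R (M * n) (- (t%:Z * i%:Z))) *: f t.
  rewrite -scaler_suml; congr (_ *: _).
  have -> : (n%:Z %| t%:Z)%Z = (n%:Z %| - t%:Z)%Z by rewrite !unfold_in /= abszN.
  rewrite -sum_uroot // mulr_suml.
  apply: eq_bigr => b _; rewrite -(uroot_scale R n _ M0) [(n * M)%N]mulnC -urootD.
  by congr (uroot _ _ _); lia.
under eq_bigr do rewrite H.
(* Writing $t=sn+b$, only $b=0$ contributes. *)
rewrite (sum_ord_mul M n (fun t =>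
  ((if (n%:Z %| t%:Z)%Z then n%:R else 0) * uroot R (M * n) (- (t%:Z * i%:Z))) *: f t)).
rewrite scaler_sumr; apply: eq_bigr => s _; case: n n0 {H} => // n _.
rewrite big_ord_recl big1 ?addr0 => [|b _].
  rewrite addn0 ifT; last by apply/dvdzP; exists s%:Z; lia.
  rewrite scalerA mulrA mulVf ?pnatr_eq0 // mul1r; congr (_ *: _).
  by rewrite -(@uroot_scale R M _ n.+1) //; congr (uroot _ _ _); lia.
rewrite ifF ?mul0r ?scale0r //; apply/negbTE/negP => /dvdzP[k hk].
have bn := ltn_ord b; rewrite /= /bump /= in hk.
have [k0|k0] : k - s%:Z <= 0 \/ 1 <= k - s%:Z by lia.
- nia.
- nia.
Qed.

End FourierTransform.

(** * Toeplitz transforms and restriction of frequencies *)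

Section Toeplitz.
Variables (R : realType) (V W : lmodType R[i]).

Lemma fcoefE P (F : nat -> V -> W) k v : fcoef P F k v = dft P (fun t => F t v) k.
Proof.
congr (_ *: _); apply: eq_bigr => t _; congr (_ *: _); congr cexp.
by rewrite mulrNz intrM mulrN.
Qed.

Lemma lin_dft P (F : V -> W) f k : islin F -> F (dft P f k) = dft P (F \o f) k.
Proof.
move=> lF; rewrite /dft linZ // lin_sum //; congr (_ *: _); apply: eq_bigr => t _.
by rewrite linZ.
Qed.

(** Convolution theorem with operators in place of scalar factors: expanding the value at [t] of
    $s\mapsto F_t(f_s)$ by [idft] produces the sum over [l]. *)
Lemma conv_dft P (F : nat -> V -> W) f (r : int) : (forall t, islin (F t)) ->
  \sum_(l < P) fcoef P F (r - l%:Z) (dft P f l%:Z) = dft P (fun t => F t (f t)) r.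
Proof.
move=> lF; under eq_bigr do rewrite fcoefE /dft.
rewrite -scaler_sumr exchange_big; congr (_ *: _); apply: eq_bigr => t _ /=.
rewrite -[F t (f t)](idft (F t \o f) (ltn_ord t)) scaler_sumr; apply: eq_bigr => l _.
rewrite -(lin_dft _ _ _ (lF t)) scalerA -urootD; congr (uroot _ _ _ *: _); lia.
Qed.

Lemma fcoef_mod P (F : nat -> V -> W) k : fcoef P F (k %% P%:Z)%Z = fcoef P F k.
Proof.
apply/funext => v; rewrite !fcoefE /dft; congr (_ *: _); apply: eq_bigr => t _.
congr (_ *: _); apply: uroot_mod; apply/dvdzP; exists (t%:Z * (k %/ P%:Z)%Z).
by rewrite {2}(divz_eq k P%:Z); lia.
Qed.

Lemma toep_dft P (F : nat -> V -> W) f : (forall t, islin (F t)) ->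
  toep P F (fun r => dft P f r%:Z) = (fun r => dft P (fun t => F t (f t)) r%:Z).
Proof.
move=> lF; apply/funext => r; rewrite -conv_dft //.
by apply: eq_bigr => l _; rewrite fcoef_mod.
Qed.

Lemma sum_shift (q a : nat) (h : nat -> V) : (forall j, h (j + q)%N = h j) ->
  \sum_(j < q) h (a + j)%N = \sum_(j < q) h j.
Proof.
case: q => [|q] hq; first by rewrite !big_ord0.
elim: a => [|a <-] //; rewrite big_ord_recr [RHS]big_ord_recl /= addrC.
rewrite addn0 addSnnS hq; congr (_ + _); apply: eq_bigr => j _.
by rewrite /bump /= addSnnS.
Qed.

(* Restricting the frequencies to one residue class mod [q] averages, up to
   modulation, over the [q] time shifts by [T]. *)
Lemma dft_decimate (q T t : nat) (d : int) (f : nat -> V) : (0 < q)%N -> (0 < T)%N ->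
    (forall s, f (s + q * T)%N = f s) ->
  \sum_(r < T) uroot R T (t%:Z * r%:Z) *: dft (q * T) f ((r * q)%N%:Z + d) =
  uroot R (q * T) (- (t%:Z * d)) *: dft q (fun j => f (t + j * T)%N) d.
Proof.
move=> q0 T0 fT.
(* The phase at [t + j * T] is the one at [t] times a [q]-th root of unity, so the [q]-term sum is a
   transform of length [q]. *)
transitivity ((q%:R : R[i])^-1 *:
  \sum_(j < q) uroot R (q * T) (- ((t + j * T)%N%:Z * d)) *: f (t + j * T)%N); last first.
  rewrite /dft [RHS]scalerA [uroot _ _ _ * _]mulrC -[RHS]scalerA; congr (_ *: _).
  rewrite scaler_sumr; apply: eq_bigr => j _; rewrite scalerA -(uroot_scale R q _ T0) -urootD.
  by congr (uroot _ _ _ *: _); lia.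
pose g s := uroot R (q * T) (- (s%:Z * d)) *: f s.
have gT s : g (s + q * T)%N = g s.
  rewrite /g fT; congr (_ *: _); apply: uroot_mod; apply/dvdzP; exists (- d); lia.
(* Summing over [r] first leaves the times [s] congruent to [t] mod [T]. *)
have H (s : nat) : \sum_(r < T) uroot R T (t%:Z * r%:Z) *:
      (uroot R (q * T) (- (s%:Z * ((r * q)%N%:Z + d))) *: f s) =
    (if (T%:Z %| t%:Z - s%:Z)%Z then T%:R else 0) *: g s.
  rewrite -sum_uroot // scaler_suml; apply: eq_bigr => r _.
  rewrite /g !scalerA -!(uroot_scale R T _ q0) [(T * q)%N]mulnC -!urootD.
  by congr (uroot _ _ _ *: _); lia.
transitivity (((q * T)%:R : R[i])^-1 *:
  \sum_(s < q * T) (if (T%:Z %| t%:Z - s%:Z)%Z then T%:R else 0) *: g s).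
  rewrite scaler_sumr; under [RHS]eq_bigr do rewrite -H scaler_sumr.
  rewrite exchange_big; apply: eq_bigr => r _; rewrite /dft !scaler_sumr.
  by apply: eq_bigr => s _; rewrite !scalerA; congr (_ *: _); rewrite mulrCA !mulrA.
rewrite (sum_ord_mul q T (fun s => (if (T%:Z %| t%:Z - s%:Z)%Z then T%:R else 0) *: g s)).
rewrite natrM invfM -scalerA; congr (_ *: _); rewrite scaler_sumr.
transitivity (\sum_(j < q) g (t %% T + j * T)%N).
  apply: eq_bigr => j _; have tT := ltn_pmod t T0.
  rewrite (bigD1 (Ordinal tT)) //= [X in _ + X]big1 ?addr0 => [|b bn].
    rewrite ifT; last by apply/dvdzP; exists ((t %/ T)%:Z - j%:Z); rewrite {1}(divn_eq t T); lia.
    by rewrite scalerA mulVf ?scale1r ?pnatr_eq0 1?addnC //; lia.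
  rewrite ifF ?scale0r //; apply/negbTE/negP => /dvdzP[k hk]; case/eqP: bn; apply: val_inj => /=.
  have bT := ltn_ord b; move: hk tT; rewrite {1}(divn_eq t T).
  set a := (t %/ T)%N; set c := (t %% T)%N => hk tT.
  have [k0|[k0|k0]] : a%:Z - j%:Z - k <= -1 \/ a%:Z - j%:Z - k = 0 \/ 1 <= a%:Z - j%:Z - k by lia.
  - nia.
  - nia.
  - nia.
(* The window of [q] shifts starts at [t %% T]; by periodicity of [g] it may start at [t]. *)
rewrite -(@sum_shift q (t %/ T) (fun j => g (t %% T + j * T)%N)) => [|j]; last first.
  by rewrite mulnDl addnA gT.
apply: eq_bigr => j _; rewrite -[RHS]/(g (t + j * T)%N); congr g.
by rewrite mulnDl addnA [(_ %% _ + _)%N]addnC -divn_eq.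
Qed.
End Toeplitz.

(** * Impulse response *)

Section ImpulseResponse.
Variables (R : realType) (U X Y : lmodType R[i]).
Implicit Type S : msys U X Y.

Definition lin_sys S := forall t,
  [/\ islin (sA S t), islin (sB S t), islin (sC S t) & islin (sD S t)].

Definition periodic_sys P S := forall t,
  [/\ sA S (t + P) = sA S t, sB S (t + P) = sB S t,
      sC S (t + P) = sC S t & sD S (t + P) = sD S t].

(* The state at time [t + k + 1] caused by the input [u] at time [t]. *)
Fixpoint imp_state S k t (u : U) : X :=
  if k is k'.+1 then sA S (t + k) (imp_state S k' t u) else sB S t u.

(* The output at time [t + k] caused by the input [u] at time [t]. *)
Definition imp_resp S k t (u : U) : Y :=
  if k is k'.+1 then sC S (t + k) (imp_state S k' t u) else sD S t u.

Lemma periodic_sysM P S j : periodic_sys P S -> periodic_sys (j * P) S.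
Proof.
move=> pS; elim: j => [|j IH] t; first by rewrite mul0n addn0.
by rewrite mulSn addnA; have [-> -> -> ->] := IH (t + P)%N.
Qed.

Lemma imp_state_periodic P S k t : periodic_sys P S ->
  imp_state S k (t + P) = imp_state S k t.
Proof.
move=> pS; apply/funext => u; elim: k => [|k IH] /=; first by have [_ ->] := pS t.
by rewrite IH addnAC; have [->] := pS (t + k.+1)%N.
Qed.

Lemma imp_resp_periodic P S k t : periodic_sys P S ->
  imp_resp S k (t + P) = imp_resp S k t.
Proof.
move=> pS; apply/funext => u; case: k => [|k] /=; first by have [_ _ _ ->] := pS t.
by rewrite (imp_state_periodic _ _ pS) addnAC; have [_ _ ->] := pS (t + k.+1)%N.
Qed.

Variables (M N : nat) (M0 : (0 < M)%N) (N0 : (0 < N)%N).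
Let c := gcdn M N.
Let mb := (M %/ c)%N.
Let nb := (N %/ c)%N.
Let P := (M * nb)%N.
Variables (S : msys U X Y) (lS : lin_sys S) (pS : periodic_sys P S).

Let mbc : (mb * c)%N = M. Proof. by rewrite divnK ?dvdn_gcdl. Qed.
Let nbc : (nb * c)%N = N. Proof. by rewrite divnK ?dvdn_gcdr. Qed.
Let mb0 : (0 < mb)%N. Proof. by have := mbc; lia. Qed.
Let nb0 : (0 < nb)%N. Proof. by have := nbc; lia. Qed.
Let P0 : (0 < P)%N. Proof. by rewrite muln_gt0 M0. Qed.
Let PE : P = (N * mb)%N. Proof. by rewrite /P -{1}mbc -nbc; lia. Qed.
Let mbR : (mb%:R : R[i]) != 0. Proof. by rewrite pnatr_eq0; lia. Qed.
Let mbP t : (mb %| t + P)%N = (mb %| t)%N.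
Proof. by rewrite dvdn_addl // PE dvdn_mull. Qed.

(** An impulse train on the slots that the upsampler fills. The weight [mb] offsets the factor $N/P$
    left by the [N] impulses in a period. *)
Definition in_train (u : U) t : U := if (mb %| t)%N then mb%:R *: u else 0.

Lemma in_train_dft u : (fun p : nat => if (N %| p)%N then u else 0) =
  (fun p => dft P (in_train u) p%:Z).
Proof.
apply/funext => p.
have H (t : nat) : uroot R P (- (t%:Z * p%:Z)) *: in_train u t =
   (if (mb %| t)%N then mb%:R * uroot R P (- (t%:Z * p%:Z)) else 0) *: u.
  by rewrite /in_train; case: ifP; rewrite ?scaler0 ?scale0r // scalerA mulrC.
rewrite /dft; under eq_bigr do rewrite H.
rewrite PE (sum_ord_mul N mb (fun t =>
  (if (mb %| t)%N then mb%:R * uroot R (N * mb) (- (t%:Z * p%:Z)) else 0) *: u)).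
have H2 (s : nat) : \sum_(b < mb)
     (if (mb %| s * mb + b)%N then mb%:R * uroot R (N * mb) (- ((s * mb + b)%N%:Z * p%:Z)) else 0) *: u =
   (mb%:R * uroot R N (- p%:Z * s%:Z)) *: u.
  rewrite (bigD1 (Ordinal mb0)) //= big1 ?addr0 => [|b bn].
    rewrite addn0 dvdn_mull //; congr (_ * _ *: _); rewrite -(uroot_scale R N _ mb0).
    by congr (uroot _ _ _); lia.
  rewrite dvdn_addr ?dvdn_mull // gtnNdvd ?scale0r //.
  by rewrite lt0n; apply: contra bn => /eqP b0; apply/eqP/val_inj.
under eq_bigr do rewrite H2.
rewrite -scaler_suml -mulr_sumr sum_uroot // !scalerA natrM.
have -> : (N%:Z %| - p%:Z)%Z = (N %| p)%N by rewrite unfold_in /= abszN.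
case: ifP; last by rewrite !mulr0 scale0r.
have NR : (N%:R : R[i]) != 0 by rewrite pnatr_eq0; lia.
rewrite -[in LHS](scale1r u) => _; congr (_ *: _); field.
by rewrite NR mbR.
Qed.

(** Adding [k.+1 * P.-1] is subtracting [k.+1] modulo [P], so this is the state at time [t] due to
    an impulse of the train [k.+1] steps earlier, without truncated subtraction. *)
Definition state_train k u t : X :=
  if (mb %| t + k.+1 * P.-1)%N then mb%:R *: imp_state S k (t + k.+1 * P.-1) u else 0.

Lemma state_train_periodic k u t : state_train k u (t + P) = state_train k u t.
Proof.
by rewrite /state_train addnAC mbP (imp_state_periodic _ _ pS).
Qed.

(** Each factor of the Neumann series is one time step: [toep] applies the operator at each time and
    [ninv] delays by one. *)
Lemma iter_toep k u :
  iter k (fun w => ninv P (toep P (sA S) w))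
    (ninv P (toep P (sB S) (fun p => dft P (in_train u) p%:Z))) =
  (fun r => dft P (state_train k u) r%:Z).
Proof.
have lA t : islin (sA S t) by have [] := lS t.
have lB t : islin (sB S t) by have [] := lS t.
elim: k => [|k IH] /=.
  rewrite toep_dft //; apply: ninv_dft => [t tP|].
    have e : (t.+1 + 1 * P.-1 = t + P)%N by lia.
    rewrite /state_train /in_train e mbP /=; have [_ -> _ _] := pS t.
    by case: ifP => _; rewrite ?linZ ?lin0.
  by rewrite -[P in LHS]add0n state_train_periodic.
rewrite IH toep_dft //; apply: ninv_dft => [t tP|].
  have e : (t.+1 + k.+2 * P.-1 = t + k.+1 * P.-1 + P)%N by lia.
  rewrite /state_train e mbP (imp_state_periodic _ _ pS) /=.
  (* The offsets add up to [k.+1] full periods, so [sA S] is taken at time [t]. *)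
  have -> : (t + k.+1 * P.-1 + k.+1 = t + k.+1 * P)%N by nia.
  have [-> _ _ _] := periodic_sysM k.+1 pS t.
  by case: ifP => _; rewrite ?linZ ?lin0.
by rewrite -[P in LHS]add0n state_train_periodic.
Qed.

(* Modulo the period [P], the input time [s * nb + k * P.-1] is [s * nb - k]. *)
Lemma htf_coefE i k u : htf_coef M N S i k u =
  (M%:R)^-1 *: \sum_(s < M) uroot R M (- (s%:Z * i%:Z)) *:
    (if (mb %| s * nb + k * P.-1)%N then imp_resp S k (s * nb + k * P.-1) u else 0).
Proof.
have lC t : islin (sC S t) by have [] := lS t.
have lD t : islin (sD S t) by have [] := lS t.
(* The output train before downsampling; only its values at multiples of [nb] survive
   [sum_dft_decimate]. *)
pose G t := mb%:R *: if (mb %| t + k * P.-1)%N then imp_resp S k (t + k * P.-1) u else 0.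
rewrite /htf_coef -/c -/mb -/nb -/P in_train_dft.
transitivity ((mb%:R)^-1 *: \sum_(b < nb) dft P G (b * M + i)%N%:Z).
  congr (_ *: _); apply: eq_bigr => b _; rewrite {}/G; case: k => [|k].
    rewrite toep_dft //=; apply: eq_dft => t _.
    rewrite mul0n addn0 /in_train /=.
    by case: ifP => _; rewrite ?(linZ _ _ (lD t)) ?(lin0 (lD t)) ?scaler0.
  rewrite iter_toep toep_dft //=; apply: eq_dft => t _.
  rewrite /state_train /=.
  have -> : (t + k.+1 * P.-1 + k.+1 = t + k.+1 * P)%N by nia.
  have [_ _ -> _] := periodic_sysM k.+1 pS t.
  by case: ifP => _; rewrite ?(linZ _ _ (lC t)) ?(lin0 (lC t)) ?scaler0.
rewrite sum_dft_decimate // scalerA mulrC -scalerA scaler_sumr; congr (_ *: _).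
apply: eq_bigr => s _; rewrite scalerA mulrC -scalerA; congr (_ *: _).
by rewrite /G scalerA mulVf // scale1r.
Qed.

End ImpulseResponse.

(** * Impulse response of the compressed systems *)

Section Decimation.
Variables (R : realType) (V W : lmodType R[i]).

Lemma islin_fcoef P (F : nat -> V -> W) k : (forall t, islin (F t)) -> islin (fcoef P F k).
Proof.
move=> lF a x y; rewrite /fcoef scalerA [a * _]mulrC -scalerA
  [a *: \sum_(_ < _) _]scaler_sumr -scalerDr -big_split.
congr (_ *: _); apply: eq_bigr => t _ /=.
by rewrite lF scalerDr !scalerA [a * _]mulrC.
Qed.

(** The sum over [r] is decimation, which replaces [F] by its [q] shifts by [T]; the sum over [k] is
    then the convolution theorem of length [q] across the shifts. With [i] a block index this is a
    state update, with [i] equal to 0 an output. *)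
Lemma conv_dft_decimate (q T t : nat) (i : int) (F : nat -> V -> W) (x : nat -> V) :
    (0 < q)%N -> (0 < T)%N ->
    (forall s, islin (F s)) -> (forall s, F (s + q * T)%N = F s) ->
  \sum_(r < T) uroot R T (t%:Z * r%:Z) *: \sum_(k < q)
     fcoef (q * T) F ((r * q)%N%:Z + (i - k%:Z))
       (uroot R (q * T) (- (t%:Z * k%:Z)) *: dft q x k%:Z) =
  uroot R (q * T) (- (t%:Z * i)) *: dft q (fun j => F (t + j * T)%N (x j)) i.
Proof.
move=> q0 T0 lF pF; under eq_bigr do rewrite scaler_sumr.
rewrite exchange_big /= -(@conv_dft _ _ _ q (fun j => F (t + j * T)%N) x) //.
rewrite scaler_sumr; apply: eq_bigr => k _.
under eq_bigr do rewrite fcoefE.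
rewrite dft_decimate // => [|s]; last by rewrite pF.
rewrite -(fcoefE q (fun j => F (t + j * T)%N)) (linZ _ _ (islin_fcoef _ _ _)) //.
by rewrite scalerA -urootD; congr (uroot _ _ _ *: _); lia.
Qed.

End Decimation.

(** * State and output of the two realisations *)

Section TildeSystems.
Variables (R : realType) (U X Y : lmodType R[i]) (m n q T : nat).
Hypotheses (mnT : mperiod m n = (q * T)%N) (q0 : (0 < q)%N) (T0 : (0 < T)%N).
Variables (S : msys U X Y) (lS : lin_sys S) (pS : periodic_sys (q * T) S).

Let lA t : islin (sA S t). Proof. by have [] := lS t. Qed.
Let lB t : islin (sB S t). Proof. by have [] := lS t. Qed.
Let lC t : islin (sC S t). Proof. by have [] := lS t. Qed.
Let pA t : sA S (t + q * T)%N = sA S t. Proof. by have [] := pS t. Qed.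
Let pB t : sB S (t + q * T)%N = sB S t. Proof. by have [] := pS t. Qed.
Let pC t : sC S (t + q * T)%N = sC S t. Proof. by have [] := pS t. Qed.
Let TE : (mperiod m n %/ q)%N = T. Proof. by rewrite mnT mulKn. Qed.

Lemma cexp_uroot (P t r : nat) : cexp (2 * pi * (t%:R * r%:R) / P%:R) = uroot R P (t%:Z * r%:Z).
Proof. by rewrite /uroot intrM. Qed.

Lemma cexpN_uroot (P k : nat) : cexp (- (2 * pi * k%:R) / P%:R) = uroot R P (- k%:Z).
Proof. by rewrite /uroot mulrNz mulrN. Qed.

Lemma tilde_D t u :
  (q%:R : R[i])^-1 *: (\sum_(k < q) sD S (t %% T + k * T)%N u) =
  dft q (fun j => sD S (t + j * T)%N u) 0.
Proof.
rewrite /dft; congr (_ *: _); under [RHS]eq_bigr do rewrite mulr0 oppr0 uroot0 scale1r.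
rewrite -(@sum_shift _ Y q (t %/ T) (fun j => sD S (t %% T + j * T)%N u)) => [|j].
  by apply: eq_bigr => j _; rewrite mulnDl addnA [(_ %% _ + _)%N]addnC -divn_eq.
by rewrite mulnDl addnA; have [_ _ _ ->] := pS (t %% T + j * T)%N.
Qed.

(** The state is the one at time $t+k+1$, but its phase has exponent $t+k$. The factors [epsinv] on
    the columns of the state and output operators supply the missing step when the state is read. *)
Lemma tilde1_state k t u (i : 'I_q) :
  imp_state (tilde_sys1 m n q S) k t u i =
  uroot R (q * T) (- ((t + k)%N%:Z * i%:Z)) *: dft q (fun j => imp_state S k (t + j * T) u) i%:Z.
Proof.
elim: k i => [|k IH] i /=; rewrite ffunE TE mnT.
  rewrite addn0 -(@dft_decimate _ _ q T t i%:Z (fun s => sB S s u)) // => [|s]; last by rewrite pB.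
  by apply: eq_bigr => r _; rewrite cexp_uroot fcoefE PoszD.
have -> : (fun j => sA S (t + j * T + k.+1)%N (imp_state S k (t + j * T) u)) =
    (fun j => sA S (t + k.+1 + j * T)%N (imp_state S k (t + j * T) u)).
  by apply/funext => j; rewrite addnAC.
rewrite -(@conv_dft_decimate _ _ _ q T (t + k.+1) i%:Z (sA S)
    (fun j => imp_state S k (t + j * T) u)) //.
apply: eq_bigr => r _; rewrite cexp_uroot; congr (_ *: _).
apply: eq_bigr => l _; rewrite cexpN_uroot IH.
rewrite -(linZ _ _ (islin_fcoef _ _ lA)) scalerA -urootD.
by congr (fcoef _ _ _ (uroot _ _ _ *: _)); lia.
Qed.

(** Here the phase has the exponent $t+k+1$ of the time of the state: the row factors of the state
    and input operators supply it when the state is written. *)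
Lemma tilde2_state k t u (i : 'I_q) :
  imp_state (tilde_sys2 m n q S) k t u i =
  uroot R (q * T) (- ((t + k).+1%:Z * i%:Z)) *: dft q (fun j => imp_state S k (t + j * T) u) i%:Z.
Proof.
(* Splits off the row factor [epsinv i], the last step of the phase. *)
have E s : uroot R (q * T) (- (s.+1%:Z * i%:Z)) =
           uroot R (q * T) (- i%:Z) * uroot R (q * T) (- (s%:Z * i%:Z)).
  by rewrite -urootD; congr (uroot _ _ _); lia.
have E2 (a b : R[i]) (v : X) : a *: (b *: v) = b *: (a *: v) by rewrite !scalerA mulrC.
elim: k i E => [|k IH] i E /=; rewrite ffunE TE mnT E -scalerA.
  rewrite addn0 -(@dft_decimate _ _ q T t i%:Z (fun s => sB S s u)) // => [|s]; last by rewrite pB.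
  rewrite scaler_sumr.
  by apply: eq_bigr => r _; rewrite cexp_uroot cexpN_uroot fcoefE PoszD E2.
have -> : (fun j => sA S (t + j * T + k.+1)%N (imp_state S k (t + j * T) u)) =
    (fun j => sA S (t + k.+1 + j * T)%N (imp_state S k (t + j * T) u)).
  by apply/funext => j; rewrite addnAC.
rewrite -(@conv_dft_decimate _ _ _ q T (t + k.+1) i%:Z (sA S)
    (fun j => imp_state S k (t + j * T) u)) // scaler_sumr; apply: eq_bigr => r _.
rewrite cexp_uroot cexpN_uroot E2; do 2 congr (_ *: _).
apply: eq_bigr => l _; rewrite IH => [|s]; last first.
  by rewrite -urootD; congr (uroot _ _ _); lia.
by congr (fcoef _ _ _ (uroot _ _ _ *: _)); lia.
Qed.

(** For positive delay the output is the case of frequency 0 in [conv_dft_decimate], for delay 0 it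
    is [tilde_D]; frequency 0 across the copies is the mean. *)
Lemma tilde1_resp k t u : imp_resp (tilde_sys1 m n q S) k t u =
  (q%:R)^-1 *: \sum_(j < q) imp_resp S k (t + j * T) u.
Proof.
transitivity (dft q (fun j => imp_resp S k (t + j * T) u) 0); last first.
  by congr (_ *: _); apply: eq_bigr => j _; rewrite mulr0 oppr0 uroot0 scale1r.
case: k => [|k] /=; rewrite TE ?tilde_D //.
have -> : (fun j => sC S (t + j * T + k.+1)%N (imp_state S k (t + j * T) u)) =
    (fun j => sC S (t + k.+1 + j * T)%N (imp_state S k (t + j * T) u)).
  by apply/funext => j; rewrite addnAC.
(* A phase equal to 1 is inserted to match the right-hand side of [conv_dft_decimate]. *)
rewrite (_ : dft q _ 0 = uroot R (q * T) (- ((t + k.+1)%N%:Z * 0)) *: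
    dft q (fun j => sC S (t + k.+1 + j * T)%N (imp_state S k (t + j * T) u)) 0); last first.
  by rewrite mulr0 oppr0 uroot0 scale1r.
rewrite -(@conv_dft_decimate _ _ _ q T (t + k.+1) 0 (sC S)
    (fun j => imp_state S k (t + j * T) u)) //.
apply: eq_bigr => r _; rewrite cexp_uroot mnT; congr (_ *: _).
apply: eq_bigr => l _; rewrite cexpN_uroot tilde1_state.
rewrite -(linZ _ _ (islin_fcoef _ _ lC)) scalerA -urootD.
by congr (fcoef _ _ _ (uroot _ _ _ *: _)); lia.
Qed.

Lemma tilde2_resp k t u : imp_resp (tilde_sys2 m n q S) k t u =
  (q%:R)^-1 *: \sum_(j < q) imp_resp S k (t + j * T) u.
Proof.
transitivity (dft q (fun j => imp_resp S k (t + j * T) u) 0); last first.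
  by congr (_ *: _); apply: eq_bigr => j _; rewrite mulr0 oppr0 uroot0 scale1r.
case: k => [|k] /=; rewrite TE ?tilde_D //.
have -> : (fun j => sC S (t + j * T + k.+1)%N (imp_state S k (t + j * T) u)) =
    (fun j => sC S (t + k.+1 + j * T)%N (imp_state S k (t + j * T) u)).
  by apply/funext => j; rewrite addnAC.
rewrite (_ : dft q _ 0 = uroot R (q * T) (- ((t + k.+1)%N%:Z * 0)) *:
    dft q (fun j => sC S (t + k.+1 + j * T)%N (imp_state S k (t + j * T) u)) 0); last first.
  by rewrite mulr0 oppr0 uroot0 scale1r.
rewrite -(@conv_dft_decimate _ _ _ q T (t + k.+1) 0 (sC S)
    (fun j => imp_state S k (t + j * T) u)) //.
apply: eq_bigr => r _; rewrite cexp_uroot mnT; congr (_ *: _).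
(* The state already carries the phase of the output time, so no factor has to be absorbed. *)
apply: eq_bigr => l _; rewrite tilde2_state.
by congr (fcoef _ _ _ (uroot _ _ _ *: _)); lia.
Qed.

Lemma tilde1_periodic : periodic_sys T (tilde_sys1 m n q S).
Proof.
have w t r : uroot R T ((t + T)%N%:Z * r%:Z) = uroot R T (t%:Z * r%:Z).
  by apply: uroot_mod; apply/dvdzP; exists r%:Z; lia.
move=> t; split; apply/funext => x /=; rewrite ?TE.
- by apply/ffunP => i; rewrite !ffunE; apply: eq_bigr => r _; rewrite !cexp_uroot w.
- by apply/ffunP => i; rewrite !ffunE; apply: eq_bigr => r _; rewrite !cexp_uroot w.
- by apply: eq_bigr => r _; rewrite !cexp_uroot w.
- by congr (_ *: _); apply: eq_bigr => k _; rewrite modnDr.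
Qed.

Lemma tilde2_periodic : periodic_sys T (tilde_sys2 m n q S).
Proof.
have w t r : uroot R T ((t + T)%N%:Z * r%:Z) = uroot R T (t%:Z * r%:Z).
  by apply: uroot_mod; apply/dvdzP; exists r%:Z; lia.
move=> t; split; apply/funext => x /=; rewrite ?TE.
- by apply/ffunP => i; rewrite !ffunE; apply: eq_bigr => r _; rewrite !cexp_uroot w.
- by apply/ffunP => i; rewrite !ffunE; apply: eq_bigr => r _; rewrite !cexp_uroot w.
- by apply: eq_bigr => r _; rewrite !cexp_uroot w.
- by congr (_ *: _); apply: eq_bigr => k _; rewrite modnDr.
Qed.

End TildeSystems.

(** * Pre-Hilbert spaces and bounded operators *)

Section PreHilbert.
Variable R : realType.

Definition prehilbert (V : lmodType R[i]) (ip : V -> V -> R[i]) :=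
  [/\ (forall x y, ip y x = conjc (ip x y)),
      (forall (a : R[i]) x y z, ip (a *: x + y) z = a * ip x z + ip y z) &
      (forall x, 0 <= ip x x)].

Definition nsq (V : lmodType R[i]) (ip : V -> V -> R[i]) (x : V) : R := complex.Re (ip x x).

Lemma ReD (z w : R[i]) : complex.Re (z + w) = complex.Re z + complex.Re w.
Proof. by case: z; case: w. Qed.

Lemma Re_sum I (r : seq I) (p : pred I) (F : I -> R[i]) :
  complex.Re (\sum_(i <- r | p i) F i) = \sum_(i <- r | p i) complex.Re (F i).
Proof. exact: (big_morph (@complex.Re R) ReD (erefl _)). Qed.

Section Theory.
Variables (V : lmodType R[i]) (ip : V -> V -> R[i]) (H : prehilbert ip).

Let ipl z : islin (fun x => ip x z : R[i]^o). Proof. by case: H => _ h _ a x y; exact: h. Qed.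

Lemma ip_conj x y : ip y x = conjc (ip x y). Proof. by case: H. Qed.

Lemma ipDl x y z : ip (x + y) z = ip x z + ip y z.
Proof. by have := ipl z 1 x y; rewrite !scale1r. Qed.

Lemma ipZl a x z : ip (a *: x) z = a * ip x z.
Proof. exact: (linZ a x (ipl z)). Qed.

Lemma ip_suml I (r : seq I) (p : pred I) (F : I -> V) z :
  ip (\sum_(i <- r | p i) F i) z = \sum_(i <- r | p i) ip (F i) z.
Proof. exact: (lin_sum r p F (ipl z)). Qed.

Lemma ip0l z : ip 0 z = 0.
Proof. exact: (lin0 (ipl z)). Qed.

Lemma ipDr x y z : ip z (x + y) = ip z x + ip z y.
Proof. by rewrite ip_conj ipDl rmorphD /= -!ip_conj. Qed.

Lemma ipZr a x z : ip z (a *: x) = conjc a * ip z x.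
Proof. by rewrite ip_conj ipZl rmorphM /= -ip_conj. Qed.

Lemma ip_sumr I (r : seq I) (p : pred I) (F : I -> V) z :
  ip z (\sum_(i <- r | p i) F i) = \sum_(i <- r | p i) ip z (F i).
Proof. by rewrite ip_conj ip_suml rmorph_sum; apply: eq_bigr => i _ /=; rewrite -ip_conj. Qed.

Lemma ipxx x : ip x x = (nsq ip x)%:C%C.
Proof.
by case: H => _ _ /(_ x); rewrite lecE /nsq; case: (ip x x) => a b /= /andP[/eqP -> _].
Qed.

Lemma nsq_ge0 x : 0 <= nsq ip x.
Proof. by case: H => _ _ /(_ x); rewrite lecE => /andP[]. Qed.

Lemma hnorm_sqr x : hnorm ip x ^+ 2 = nsq ip x.
Proof. by rewrite sqr_sqrtr ?nsq_ge0. Qed.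

Lemma nsqD x y : nsq ip (x + y) = nsq ip x + nsq ip y + 2 * complex.Re (ip x y).
Proof.
rewrite /nsq ipDl !ipDr !ReD (ip_conj x y); case: (ip x y) => a b /=; lra.
Qed.

Lemma nsqZ a x : nsq ip (a *: x) = (complex.Re a ^+ 2 + complex.Im a ^+ 2) * nsq ip x.
Proof.
rewrite {1}/nsq ipZl ipZr ipxx; case: a => a b /=; set c := nsq ip x; ring.
Qed.

(* The parallelogram law makes Cauchy-Schwarz unnecessary for boundedness. *)
Lemma nsqD_le x y : nsq ip (x + y) <= 2 * (nsq ip x + nsq ip y).
Proof.
have := nsq_ge0 (x + (-1) *: y); rewrite !nsqD nsqZ ipZr.
case: (ip x y) => a b /=; set c := nsq ip x; set d := nsq ip y; lra.
Qed.

(** Expanding both arguments gives a double sum over times; the sum over [i] is a character sum that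
    leaves only the diagonal. *)
Lemma parseval M (g : nat -> V) : (0 < M)%N ->
  \sum_(i < M) nsq ip ((M%:R)^-1 *: \sum_(s < M) uroot R M (- (s%:Z * i%:Z)) *: g s) =
  (M%:R)^-1 * \sum_(s < M) nsq ip (g s).
Proof.
(* Lifted to complex numbers, squared norms are inner products and can be expanded. *)
move=> M0; apply: (@complexI R).
have MR : (M%:R : R[i]) != 0 by rewrite pnatr_eq0; lia.
rewrite rmorphM fmorphV !rmorph_sum rmorph_nat /=.
under eq_bigr do rewrite -ipxx.
under [in RHS]eq_bigr do rewrite -ipxx.
have E (i : 'I_M) : ip ((M%:R)^-1 *: \sum_(s < M) uroot R M (- (s%:Z * i%:Z)) *: g s)
    ((M%:R)^-1 *: \sum_(s < M) uroot R M (- (s%:Z * i%:Z)) *: g s) =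
    \sum_(s < M) \sum_(s' < M) (M%:R)^-1 * (M%:R)^-1 * uroot R M ((s'%:Z - s%:Z) * i%:Z) * ip (g s) (g s').
  rewrite ipZl ipZr conjc_inv conjc_nat mulrA ip_suml mulr_sumr; apply: eq_bigr => s _.
  rewrite ipZl ip_sumr !mulr_sumr; apply: eq_bigr => s' _.
  rewrite ipZr conj_uroot opprK -!mulrA; do 2 congr (_ * _).
  by rewrite !mulrA -urootD; congr (uroot _ _ _ * _); lia.
under eq_bigr do rewrite E.
rewrite exchange_big mulr_sumr; apply: eq_bigr => s _ /=; rewrite exchange_big /=.
have E2 (s' : 'I_M) :
   \sum_(i < M) (M%:R)^-1 * (M%:R)^-1 * uroot R M ((s'%:Z - s%:Z) * i%:Z) * ip (g s) (g s') =
   (M%:R)^-1 * (M%:R)^-1 * (if (M%:Z %| s'%:Z - s%:Z)%Z then M%:R else 0) * ip (g s) (g s').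
  by rewrite -sum_uroot // mulr_sumr mulr_suml.
under eq_bigr do rewrite E2.
rewrite (bigD1 s) //= subrr dvdz0 mulfVK // big1 ?addr0 // => s' ss'.
rewrite ifF ?mulr0 ?mul0r //; apply/negbTE/negP => /dvdzP[k hk].
have sM := ltn_ord s; have sM' := ltn_ord s'.
have ne : s' <> s :> nat by move=> h; case/eqP: ss'; apply: val_inj.
have [k0|[k0|k0]] : k <= -1 \/ k = 0 \/ 1 <= k by lia.
- nia.
- lia.
- nia.
Qed.

(** With [c] the mean, $a_j-h=(a_j-c)+(c-h)$, and the cross terms add up to 0 because the deviations
    from the mean do. *)
Lemma nsq_mean_le q (a : nat -> V) (h : V) : (0 < q)%N ->
  \sum_(j < q) nsq ip (a j - (q%:R)^-1 *: \sum_(l < q) a l) <= \sum_(j < q) nsq ip (a j - h).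
Proof.
move=> q0; set c := _ *: _.
have qR : (q%:R : R[i]) != 0 by rewrite pnatr_eq0; lia.
have E (j : 'I_q) : nsq ip (a j - h) =
    nsq ip (a j - c) + (nsq ip (c - h) + 2 * complex.Re (ip (a j - c) (c - h))).
  by rewrite addrA -nsqD addrA subrK.
under [leRHS]eq_bigr do rewrite E.
rewrite big_split /= lerDl big_split /=; apply: addr_ge0.
  by apply: sumr_ge0 => j _; exact: nsq_ge0.
rewrite -mulr_sumr -Re_sum -ip_suml sumrB sumr_const card_ord.
rewrite -[c *+ q]scaler_nat /c scalerA mulfV // scale1r subrr ip0l mulr0 //.
Qed.

End Theory.

Lemma ip_pow_prehilbert (V : lmodType R[i]) (ip : V -> V -> R[i]) q :
  prehilbert ip -> prehilbert (@ip_pow R V q ip).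
Proof.
move=> H; case: (H) => h1 h2 h3; split => [x y|a x y z|x].
- by rewrite /ip_pow rmorph_sum; apply: eq_bigr => i _; rewrite h1.
- rewrite /ip_pow mulr_sumr -big_split; apply: eq_bigr => i _.
  by rewrite !ffunE h2.
- by rewrite sumr_ge0.
Qed.

Lemma nsq_pow (V : lmodType R[i]) (ip : V -> V -> R[i]) q (x : {ffun 'I_q -> V}) :
  nsq (ip_pow ip) x = \sum_(i < q) nsq ip (x i).
Proof. by rewrite /nsq /ip_pow Re_sum. Qed.

(** * Bounded operators and finite powers of a space *)

Section Bounded.
Variables (V W : lmodType R[i]) (ipV : V -> V -> R[i]) (ipW : W -> W -> R[i]).
Hypotheses (HV : prehilbert ipV) (HW : prehilbert ipW).
Implicit Type f g : V -> W.

Lemma bounded_opP f : bounded_op ipV ipW f <->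
  islin f /\ exists2 M, 0 <= M & forall x, nsq ipW (f x) <= M * nsq ipV x.
Proof.
split=> [[lf [M hM]]|[lf [M M0 hM]]]; split=> //.
  exists (M ^+ 2) => [|x]; first exact: sqr_ge0.
  rewrite -!hnorm_sqr // -exprMn; apply: lerXn2r (hM x); rewrite nnegrE ?sqrtr_ge0 //.
  (* [M] has no known sign, but [M * hnorm ipV x] dominates a norm. *)
  by apply: le_trans (hM x); rewrite sqrtr_ge0.
by exists (Num.sqrt M) => x; rewrite /hnorm -sqrtrM //; apply: ler_wsqrtr; exact: hM.
Qed.

Lemma bounded_opD f g : bounded_op ipV ipW f -> bounded_op ipV ipW g ->
  bounded_op ipV ipW (fun x => f x + g x).
Proof.
move=> /bounded_opP[lf [M M0 hf]] /bounded_opP[lg [N N0 hg]]; apply/bounded_opP; split.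
  by move=> a x y; rewrite lf lg scalerDr addrACA.
exists (2 * (M + N)) => [|x]; first by rewrite mulr_ge0 ?addr_ge0.
apply: le_trans (nsqD_le HW _ _) _; have := hf x; have := hg x; lra.
Qed.

Lemma bounded_opZ a f : bounded_op ipV ipW f -> bounded_op ipV ipW (fun x => a *: f x).
Proof.
move=> /bounded_opP[lf [M M0 hf]]; apply/bounded_opP; split.
  by move=> b x y; rewrite lf scalerDr !scalerA [a * _]mulrC.
have a0 : 0 <= complex.Re a ^+ 2 + complex.Im a ^+ 2 by rewrite addr_ge0 ?sqr_ge0.
exists ((complex.Re a ^+ 2 + complex.Im a ^+ 2) * M) => [|x]; first exact: mulr_ge0.
by rewrite nsqZ // -mulrA ler_wpM2l.
Qed.

Lemma bounded_op_sum I (r : seq I) (F : I -> V -> W) :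
  (forall i, bounded_op ipV ipW (F i)) -> bounded_op ipV ipW (fun x => \sum_(i <- r) F i x).
Proof.
move=> hF; elim: r => [|i r IH].
  apply/bounded_opP; split=> [a x y|]; first by rewrite !big_nil scaler0 addr0.
  by exists 0 => // x; rewrite big_nil mul0r /nsq ip0l.
have -> : (fun x => \sum_(j <- i :: r) F j x) = (fun x => F i x + \sum_(j <- r) F j x).
  by apply/funext => x; rewrite big_cons.
exact: bounded_opD.
Qed.

Lemma bounded_op_fcoef T (F : nat -> V -> W) k :
  (forall t, bounded_op ipV ipW (F t)) -> bounded_op ipV ipW (fcoef T F k).
Proof. by move=> hF; apply: bounded_opZ; apply: bounded_op_sum => t; apply: bounded_opZ. Qed.

Lemma bounded_op_proj q (f : V -> W) (k : 'I_q) : bounded_op ipV ipW f ->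
  bounded_op (ip_pow ipV) ipW (fun x : {ffun 'I_q -> V} => f (x k)).
Proof.
move=> [lf [M hf]]; split=> [a x y|]; first by rewrite !ffunE lf.
(* The constant must be nonnegative for the bound on the block [x k] by the whole of [x] to pass
   through it. *)
exists (Num.max M 0) => x; apply: le_trans (hf _) _.
have : hnorm ipV (x k) <= hnorm (ip_pow ipV) x.
  apply: ler_wsqrtr; rewrite -!/(nsq _ _) nsq_pow (bigD1 k) //= lerDl.
  by rewrite sumr_ge0 // => i _; exact: nsq_ge0.
move=> h; apply: le_trans (_ : Num.max M 0 * hnorm ipV (x k) <= _).
  by rewrite ler_wpM2r ?sqrtr_ge0 // le_max lexx.
by rewrite ler_wpM2l // le_max lexx orbT.
Qed.

Lemma bounded_op_ffun q (F : 'I_q -> V -> W) : (forall i, bounded_op ipV ipW (F i)) ->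
  bounded_op ipV (ip_pow ipW) (fun x => [ffun i => F i x]).
Proof.
move=> hF; split=> [a x y|].
  by apply/ffunP => i; rewrite !ffunE; have [-> _] := hF i.
have /choice[M hM] : forall i, exists M, 0 <= M /\ forall x, nsq ipW (F i x) <= M * nsq ipV x.
  by move=> i; have /bounded_opP[_ [M M0 h]] := hF i; exists M.
exists (Num.sqrt (\sum_i M i)) => x; have M0 : 0 <= \sum_i M i by apply: sumr_ge0 => i _; case: (hM i).
rewrite /hnorm -sqrtrM //; apply: ler_wsqrtr; rewrite -!/(nsq _ _) nsq_pow mulr_suml; apply: ler_sum => i _.
by rewrite ffunE; case: (hM i).
Qed.

End Bounded.
End PreHilbert.

(** * Optimality *)

Section ErrorSystem.
Variables (R : realType) (U X Xh Y : lmodType R[i]).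
Variables (S : msys U X Y) (Sh : msys U Xh Y).

Lemma err_state k t u :
  imp_state (err_sys S Sh) k t u = (imp_state S k t u, imp_state Sh k t u).
Proof. by elim: k => [|k IH] //=; rewrite IH. Qed.

Lemma err_resp k t u :
  imp_resp (err_sys S Sh) k t u = imp_resp S k t u - imp_resp Sh k t u.
Proof. by case: k => [|k] //=; rewrite err_state. Qed.

Lemma err_lin : lin_sys S -> lin_sys Sh -> lin_sys (err_sys S Sh).
Proof.
move=> lS lSh t; have [a b c d] := lS t; have [a' b' c' d'] := lSh t.
by split=> z x y /=; rewrite ?a ?b ?c ?d ?a' ?b' ?c' ?d' // scalerBr opprD addrACA.
Qed.

Lemma err_periodic P :
  periodic_sys P S -> periodic_sys P Sh -> periodic_sys P (err_sys S Sh).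
Proof.
by move=> pS pSh t; have [a b c d] := pS t; have [a' b' c' d'] := pSh t; split=> /=;
  rewrite ?a ?b ?c ?d ?a' ?b' ?c' ?d'.
Qed.

End ErrorSystem.

(** The gcd scales with [q], so $\overline n$ is unchanged and only the factor [m] of the period
    shrinks. *)
Lemma mperiod_div m n q : (q %| m)%N -> (q %| n)%N ->
  mperiod m n = (q * mperiod (m %/ q) (n %/ q))%N.
Proof.
move=> qm qn; rewrite /mperiod mulnA [(q * _)%N]mulnC divnK //.
by rewrite -divnMA [(q * _)%N]mulnC muln_gcdl !divnK.
Qed.

Section Optimality.
Variables (R : realType) (U X Y : lmodType R[i]).
Variables (ipU : U -> U -> R[i]) (ipX : X -> X -> R[i]) (ipY : Y -> Y -> R[i]).
Variables (L : set nat) (e : nat -> U) (HY : prehilbert ipY).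

(** Nonnegativity lets the finite sum over [i] pass inside both infinite sums, where [parseval]
    applies for each basis vector and delay. *)
Lemma htf_norm2E M N (V : lmodType R[i]) (S : msys U V Y) : (0 < M)%N -> (0 < N)%N ->
    lin_sys S -> periodic_sys (mperiod M N) S ->
  htf_norm2 ipY L e M N S =
  (\esum_(l in L) \esum_(k in [set: nat])
     ((M%:R)^-1 * \sum_(s < M) nsq ipY
        (if (M %/ gcdn M N %| s * (N %/ gcdn M N) + k * (mperiod M N).-1)%N
         then imp_resp S k (s * (N %/ gcdn M N) + k * (mperiod M N).-1) (e l) else 0))%:E)%E.
Proof.
move=> M0 N0 lS pS; rewrite /htf_norm2 -esum_sum => [|l i _ _]; last first.
  by apply: esum_ge0 => k _; rewrite lee_fin sqr_ge0.
apply: eq_esum => l _; rewrite -esum_sum => [|k i _ _]; last by rewrite lee_fin sqr_ge0.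
apply: eq_esum => k _; rewrite sumEFin; congr (_%:E).
rewrite -(parseval HY (fun s => if (M %/ gcdn M N %| s * (N %/ gcdn M N) + k * (mperiod M N).-1)%N
  then imp_resp S k (s * (N %/ gcdn M N) + k * (mperiod M N).-1) (e l) else 0) M0).
by apply: eq_bigr => i _; rewrite hnorm_sqr // htf_coefE.
Qed.

Lemma multirate_lin m n (V : lmodType R[i]) (ipV : V -> V -> R[i]) (S : msys U V Y) :
  is_multirate ipU ipV ipY m n S -> lin_sys S.
Proof. by move=> [_ _ _ h] t; have [[? _] [? _] [? _] [? _]] := h t. Qed.

(** The terms are nonnegative but their sum may be infinite, so the comparison is made for each [l]
    and [k] separately. On a group of output times differing by shifts of the small period the
    competitor's response is constant, and [nsq_mean_le] applies. *)
Lemma mean_optimal m n q (Xt : lmodType R[i]) (S : msys U X Y) (St : msys U Xt Y) :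
    (0 < m)%N -> (0 < n)%N -> (0 < q)%N -> (q %| m)%N -> (q %| n)%N ->
    lin_sys S -> periodic_sys (mperiod m n) S ->
    lin_sys St -> periodic_sys (mperiod (m %/ q) (n %/ q)) St ->
    (forall k t u, imp_resp St k t u =
       (q%:R)^-1 *: \sum_(j < q) imp_resp S k (t + j * mperiod (m %/ q) (n %/ q)) u) ->
  optimal_approx ipU ipY L e m n S (m %/ q) (n %/ q) St.
Proof.
move=> m0 n0 q0 qm qn lS pS lSt pSt rSt Xh ipXh _ Sh hSh.
have lSh := multirate_lin hSh; case: hSh => _ _ pSh _.
have cq : (gcdn (m %/ q) (n %/ q) * q)%N = gcdn m n by rewrite muln_gcdl !divnK.
(* Hence both error systems are taken as [(m, n)]-multirate and use the same sampling times. *)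
have C : lcmn (gcdn m n) (gcdn (m %/ q) (n %/ q)) = gcdn m n.
  by apply/lcmn_idPl; rewrite -cq dvdn_mulr.
have nbE : (n %/ q %/ gcdn (m %/ q) (n %/ q))%N = (n %/ gcdn m n)%N.
  by rewrite -divnMA mulnC cq.
have TE : mperiod (m %/ q) (n %/ q) = (m %/ q * (n %/ gcdn m n))%N by rewrite /mperiod nbE.
have PE := mperiod_div qm qn.
have pSt' : periodic_sys (mperiod m n) St by rewrite PE; exact: periodic_sysM.
have pSh' : periodic_sys (mperiod m n) Sh by rewrite PE; exact: periodic_sysM.
have mE : (gcdn m n * (m %/ gcdn m n))%N = m by rewrite mulnC divnK ?dvdn_gcdl.
have nE : (gcdn m n * (n %/ gcdn m n))%N = n by rewrite mulnC divnK ?dvdn_gcdr.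
rewrite /err_norm2 C mE nE.
rewrite !htf_norm2E //; try exact: err_lin; try exact: err_periodic.
apply: le_esum => l _; apply: le_esum => k _; rewrite lee_fin ler_wpM2l //.
set mb := (m %/ gcdn m n)%N; set nb := (n %/ gcdn m n)%N.
pose g V (S' : msys U V Y) s := nsq ipY (if (mb %| s * nb + k * (mperiod m n).-1)%N
  then imp_resp (err_sys S S') k (s * nb + k * (mperiod m n).-1) (e l) else 0).
suff : \sum_(s < q * (m %/ q)) g Xt St s <= \sum_(s < q * (m %/ q)) g Xh Sh s.
  by rewrite mulnC divnK.
(* Output times are [j * (m %/ q) + b]; for fixed [b], [j] runs over the [q] shifts. *)
rewrite !sum_ord_mul exchange_big [leRHS]exchange_big; apply: ler_sum => b _ /=.
pose t := (b * nb + k * (mperiod m n).-1)%N.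
have tE j : ((j * (m %/ q) + b) * nb + k * (mperiod m n).-1 =
             t + j * mperiod (m %/ q) (n %/ q))%N.
  by rewrite /t TE -/nb; lia.
(* The small period is a multiple of [mb] because [m %/ q] is, so compatibility with the input
   sampler is the same for all shifts. *)
have mbE j : (mb %| t + j * mperiod (m %/ q) (n %/ q))%N = (mb %| t)%N.
  rewrite dvdn_addl // dvdn_mull // TE dvdn_mulr //; apply/dvdnP.
  exists (gcdn (m %/ q) (n %/ q)); apply/eqP; rewrite -(eqn_pmul2r q0) divnK //.
  by rewrite mulnAC cq mulnC divnK ?dvdn_gcdl.
have rE V (S' : msys U V Y) j : periodic_sys (mperiod (m %/ q) (n %/ q)) S' ->
    imp_resp S' k (t + j * mperiod (m %/ q) (n %/ q)) = imp_resp S' k t.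
  by move=> pS'; apply: imp_resp_periodic; exact: periodic_sysM.
have gE V (S' : msys U V Y) j : periodic_sys (mperiod (m %/ q) (n %/ q)) S' ->
   g V S' (j * (m %/ q) + b)%N = nsq ipY (if (mb %| t)%N then
     imp_resp S k (t + j * mperiod (m %/ q) (n %/ q)) (e l) - imp_resp S' k t (e l) else 0).
  by move=> pS'; rewrite /g tE mbE err_resp (rE _ _ _ pS').
under eq_bigr do rewrite gE //.
under [leRHS]eq_bigr do rewrite gE //.
(* At times incompatible with the samplers both sides are sums of zeros. *)
case: (mb %| t)%N => //; rewrite rSt.
exact: (nsq_mean_le HY (fun j => imp_resp S k (t + j * mperiod (m %/ q) (n %/ q)) (e l))).
Qed.

End Optimality.

(** * Boundedness of the compressed systems *)

Section TildeMultirate.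
Variables (R : realType) (U X Y : lmodType R[i]).
Variables (ipU : U -> U -> R[i]) (ipX : X -> X -> R[i]) (ipY : Y -> Y -> R[i]).
Hypotheses (HU : prehilbert ipU) (HX : prehilbert ipX) (HY : prehilbert ipY).
Variables (m n q : nat) (S : msys U X Y).
Hypothesis bS : forall t, [/\ bounded_op ipX ipX (sA S t), bounded_op ipU ipX (sB S t),
                     bounded_op ipX ipY (sC S t) & bounded_op ipU ipY (sD S t)].

Let HXq := ip_pow_prehilbert q HX.
Let bA t : bounded_op ipX ipX (sA S t). Proof. by have [] := bS t. Qed.
Let bB t : bounded_op ipU ipX (sB S t). Proof. by have [] := bS t. Qed.
Let bC t : bounded_op ipX ipY (sC S t). Proof. by have [] := bS t. Qed.
Let bD t : bounded_op ipU ipY (sD S t). Proof. by have [] := bS t. Qed.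

Lemma tilde1_bounded t : let St := tilde_sys1 m n q S in
  [/\ bounded_op (ip_pow ipX) (ip_pow ipX) (sA St t), bounded_op ipU (ip_pow ipX) (sB St t),
      bounded_op (ip_pow ipX) ipY (sC St t) & bounded_op ipU ipY (sD St t)].
Proof.
split=> /=.
- apply: bounded_op_ffun => // i; apply: bounded_op_sum => // r; apply: bounded_opZ => //.
  apply: bounded_op_sum => // k; apply: bounded_opZ => //.
  by apply: bounded_op_proj => //; apply: bounded_op_fcoef.
- apply: bounded_op_ffun => // i; apply: bounded_op_sum => // r; apply: bounded_opZ => //.
  exact: bounded_op_fcoef.
- apply: bounded_op_sum => // r; apply: bounded_opZ => //.
  apply: bounded_op_sum => // k; apply: bounded_opZ => //.
  by apply: bounded_op_proj => //; apply: bounded_op_fcoef.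
- by apply: bounded_opZ => //; apply: bounded_op_sum.
Qed.

Lemma tilde2_bounded t : let St := tilde_sys2 m n q S in
  [/\ bounded_op (ip_pow ipX) (ip_pow ipX) (sA St t), bounded_op ipU (ip_pow ipX) (sB St t),
      bounded_op (ip_pow ipX) ipY (sC St t) & bounded_op ipU ipY (sD St t)].
Proof.
split=> /=.
- apply: bounded_op_ffun => // i; apply: bounded_op_sum => // r; apply: bounded_opZ => //.
  apply: bounded_opZ => //; apply: bounded_op_sum => // k.
  by apply: bounded_op_proj => //; apply: bounded_op_fcoef.
- apply: bounded_op_ffun => // i; apply: bounded_op_sum => // r; apply: bounded_opZ => //.
  by apply: bounded_opZ => //; apply: bounded_op_fcoef.
- apply: bounded_op_sum => // r; apply: bounded_opZ => //.
  apply: bounded_op_sum => // k.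
  by apply: bounded_op_proj => //; apply: bounded_op_fcoef.
- by apply: bounded_opZ => //; apply: bounded_op_sum.
Qed.

End TildeMultirate.

Lemma hilbert_prehilbert (R : realType) (V : lmodType R[i]) (ip : V -> V -> R[i]) :
  is_hilbert ip -> prehilbert ip.
Proof. by case. Qed.

Unset Implicit Arguments.

Theorem theorem13 (R : realType) (U X Y : lmodType R[i])
  (ipU : U -> U -> R[i]) (ipX : X -> X -> R[i]) (ipY : Y -> Y -> R[i])
  (hU : is_hilbert ipU) (hX : is_hilbert ipX) (hY : is_hilbert ipY)
  (m n : nat) (S : msys U X Y) (hS : is_multirate ipU ipX ipY m n S)
  (q : nat) (hq : (0 < q)%N) (hqm : (q %| m)%N) (hqn : (q %| n)%N)
  (L : set nat) (e : nat -> U) (he : is_onb ipU L e) :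
  (is_multirate ipU (ip_pow ipX) ipY (m %/ q) (n %/ q) (tilde_sys1 m n q S) /\
   optimal_approx ipU ipY L e m n S (m %/ q) (n %/ q) (tilde_sys1 m n q S)) /\
  (is_multirate ipU (ip_pow ipX) ipY (m %/ q) (n %/ q) (tilde_sys2 m n q S) /\
   optimal_approx ipU ipY L e m n S (m %/ q) (n %/ q) (tilde_sys2 m n q S)).
Proof.
have [m0 n0 pS bS] := hS; have lS := multirate_lin hS.
have HU := hilbert_prehilbert hU; have HX := hilbert_prehilbert hX.
have HY := hilbert_prehilbert hY.
have TE := mperiod_div hqm hqn.
have mq0 : (0 < m %/ q)%N by rewrite divn_gt0 // dvdn_leq.
have nq0 : (0 < n %/ q)%N by rewrite divn_gt0 // dvdn_leq.
have T0 : (0 < mperiod (m %/ q) (n %/ q))%N.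
  by rewrite muln_gt0 mq0 divn_gt0 ?gcdn_gt0 ?mq0 // dvdn_leq // dvdn_gcdr.
have pS' : periodic_sys (q * mperiod (m %/ q) (n %/ q)) S by rewrite -TE.
have M1 : is_multirate ipU (ip_pow ipX) ipY (m %/ q) (n %/ q) (tilde_sys1 m n q S).
  by split=> // t; [exact: (tilde1_periodic TE)|exact: tilde1_bounded].
have M2 : is_multirate ipU (ip_pow ipX) ipY (m %/ q) (n %/ q) (tilde_sys2 m n q S).
  by split=> // t; [exact: (tilde2_periodic TE)|exact: tilde2_bounded].
split; split=> //; apply: mean_optimal => //.
- exact: multirate_lin M1.
- by case: M1.
- by move=> k t u; rewrite (tilde1_resp TE).
- exact: multirate_lin M2.
- by case: M2.
- by move=> k t u; rewrite (tilde2_resp TE).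
Qed.
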